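(* Let $x\ge 1$, $k\ge 1$, $n\ge 2$ and $y$ be integers with $T_k(x)=y^n$. Then the following hold. (i) If $x\equiv 0\pmod 4$, then $$n\le \begin{cases} v_2(x)-1, & \text{if } k=1 \text{ or } k \text{ is even},\\ 2v_2(x)-2, & \text{if } k\ge 3 \text{ is odd}.\end{cases}$$ (ii) If $x\equiv 1\pmod 4$ and $k=1$, then $n\le v_2(3x+1)-1$. If $x\equiv 1$ or $5\pmod 8$, $x\not\equiv 1\pmod{32}$ and $k\ne 1$, then $$n\le\begin{cases} v_2(7x+1)-1, & \text{if } x\equiv 1\pmod 8 \text{ and } k=2,\\ v_2((5x+3)(3x+1))-2, & \text{if } x\equiv 1\pmod 8 \text{ and } k=3,\\ v_2(3x+1), & \text{if } x\equiv 5\pmod 8 \text{ and } k\ge 3 \text{ is odd},\\ 1, & \text{if } x\equiv 5\pmod 8 \text{ and } k\ge 2 \text{ is even},\\ 2, & \text{if } x\equiv 9\pmod{16} \text{ and } k\ge 4 \text{ is even},\\ 3, & \text{if } x\equiv 9\pmod{16} \text{ and } k\ge 5 \text{ is odd, or if } x\equiv 17\pmod{32} \text{ and } k\ge 4 \text{ is even},\\ 4, & \text{if } x\equiv 17\pmod{32} \text{ and } k\ge 5 \text{ is odd}. \end{cases}$$ (iii) If either $x\equiv 0\pmod 3$ and $k$ is odd, or $x\equiv 0$ or $4\pmod 9$ and $k\ge 2$ is even, then $$n\le\begin{cases} v_3(x), & \text{if } x\equiv 0\pmod 3 \text{ and } k=1,\\ v_3(x)-1, & \text{if } x\equiv 0\pmod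 9 \text{ and } k\ge 2 \text{ is even},\\ v_3(kx^2), & \text{if } x\equiv 0\pmod 3 \text{ and } k>3 \text{ is odd},\\ v_3(x^2(5x+3)), & \text{if } x\equiv 0\pmod 3 \text{ and } k=3,\\ v_3(2x+1)-1, & \text{if } x\equiv 4\pmod 9 \text{ and } k\ge 2 \text{ is even}. \end{cases}$$
   Context: For positive integers $x,k$, $T_k(x)=(x+1)^k+(x+2)^k+\cdots+(2x)^k$. For a prime $p$ and a nonzero integer $m$, $v_p(m)$ denotes the largest exponent $v$ such that $p^v\mid m$. *)

(* Defs.v *)
From mathcomp Require Import all_boot all_order all_algebra.

Set Implicit Arguments.
Unset Strict Implicit.
Unset Printing Implicit Defensive.

Definition T (k x : nat) : nat := \sum_(1 <= i < x.+1) (x + i) ^ k.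

(* Main.v *)
(* If [p] divides [T_k(x) = y^n], then [n] divides, hence is at most, the
   [p]-adic valuation of [T_k(x)]; in every case of the theorem that valuation
   can be computed exactly. For [k = 1, 2, 3] there are closed forms. For even
   [k] and [p = 2] or [3], a sum of [k]-th powers of [N] consecutive integers,
   [p | N], has valuation [v_p(N) - 1]. For odd [k], adding such a sum to its
   reversal and expanding [(u - a)^k + a^k = k u a^(k-1) + ...] reduces it to
   the even exponent [k - 1]. For odd [k] and [8 | x - 1] this loses too much
   precision, and the valuation [v_2(x - 1)] comes from doubling the length of
   the sum, starting from blocks of length 4. *)
Require Import Defs.
From mathcomp Require Import all_boot all_order all_algebra.
From mathcomp Require Import zify ring.

Set Implicit Arguments.
Unset Strict Implicit.
Unset Printing Implicit Defensive.

Import Order.TTheory GRing.Theory Num.Theory.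
Local Open Scope ring_scope.

(** * Power sums over consecutive integers: splitting and reversal *)

(** The starting point is an arbitrary integer, so that intervals can be reflected and translated
    freely. *)
Definition psum (a : int) (n k : nat) : int := \sum_(i < n) (a + i%:Z) ^+ k.

Lemma psum_T (k x : nat) : (T k x)%:Z = psum x.+1%:Z x k.
Proof.
rewrite /T /psum big_add1 big_mkord (big_morph Posz PoszD (erefl _)) /=.
by apply: eq_bigr => i _; rewrite -PoszD addSnnS rmorphXn /=.
Qed.

Lemma psum0 a k : psum a 0 k = 0.
Proof. exact: big_ord0. Qed.

Lemma psumS a n k : psum a n.+1 k = psum a n k + (a + n%:Z) ^+ k.
Proof. exact: big_ord_recr. Qed.

Lemma psumD a m n k : psum a (m + n) k = psum a m k + psum (a + m%:Z) n k.
Proof.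
elim: n => [|n IHn]; first by rewrite addn0 psum0 addr0.
by rewrite addnS !psumS IHn -addrA -[in RHS](addrA a) -PoszD.
Qed.

Lemma psum_first a n k : psum a n.+1 k = a ^+ k + psum (a + 1) n k.
Proof. by rewrite -add1n psumD psumS psum0 add0r addr0. Qed.

Lemma psum_rev (a : int) n k :
  psum a n k = \sum_(i < n) (a *+ 2 + n%:Z - 1 - (a + i%:Z)) ^+ k.
Proof.
rewrite /psum [LHS](reindex_inj rev_ord_inj) /=.
by apply: eq_bigr => i _; congr (_ ^+ _); have := ltn_ord i; lia.
Qed.

(** * First-order expansions; reflection and block congruences *)

Lemma dvdz_exprDl_taylor (a u : int) k :
  (u ^+ 2 %| (a + u) ^+ k - a ^+ k - k%:Z * u * a ^+ k.-1)%Z.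
Proof.
case: k => [|k]; first by rewrite !expr0 subrr !mul0r subr0 dvdz0.
rewrite succnK; elim: k => [|k IHk].
  by rewrite expr0 !expr1 (_ : _ - _ = 0) ?dvdz0 //; ring.
have -> : (a + u) ^+ k.+2 - a ^+ k.+2 - k.+2%:Z * u * a ^+ k.+1 =
  ((a + u) ^+ k.+1 - a ^+ k.+1 - k.+1%:Z * u * a ^+ k) * (a + u)
  + k.+1%:Z * a ^+ k * u ^+ 2.
  by rewrite !exprS !intS; ring.
by apply: rpredD; [exact: dvdz_mulr | exact: dvdz_mull].
Qed.

(* Cubing [A + U] with [U = 3^s u w] gains one factor 3: [3 A U^2] and
   [U^3] both carry [3^(s+1) u^2] because [3 | u]. *)
Lemma dvdz_exprDl_taylor3 (a u : int) k : (0 < k)%N -> (3 %| u)%Z ->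
  ((3 ^ logn 3 k)%N%:Z * u ^+ 2 %|
     (a + u) ^+ k - a ^+ k - k%:Z * u * a ^+ k.-1)%Z.
Proof.
move=> k_gt0 /dvdzP[v ->].
have [q q3 kE] := pfactor_coprime (isT : prime 3) k_gt0.
move: (logn 3 k) kE => s ->.
have {k_gt0 q3 k} q_gt0 : (0 < q)%N by case: q q3.
elim: s => [|s /dvdzP[c IHs]].
  by rewrite expn0 muln1 mul1r dvdz_exprDl_taylor.
set k := (q * 3 ^ s)%N in IHs; set d := (3 ^ s)%N%:Z in IHs.
have kd : k%:Z = q%:Z * d by rewrite PoszM.
have k_gt0 : (0 < k)%N by rewrite muln_gt0 q_gt0 expn_gt0.
have -> : (q * 3 ^ s.+1)%N = (k * 3)%N by rewrite expnSr mulnA.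
clearbody k.
have -> : (3 ^ s.+1)%N%:Z = 3 * d by rewrite expnS PoszM.
have -> : (k * 3).-1 = (k.-1 + k * 2)%N by lia.
rewrite PoszM exprD !exprM.
move/eqP: IHs; rewrite -addrA -opprD subr_eq => /eqP->.
set A := a ^+ k; set B := a ^+ k.-1.
apply/dvdzP.
(* With u = 3v and U = d u (c u + q B), these are 3 A^2 (U - k u B), 3 A U^2 and U^3, each divided
   by 3 d u^2. *)
exists (A ^+ 2 * c + A * (d * (c * (v * 3) + q%:Z * B) ^+ 2)
  + d ^+ 2 * v * (c * (v * 3) + q%:Z * B) ^+ 3).
by rewrite kd; ring.
Qed.

Lemma dvdz_sumr (I : Type) (r : seq I) (P : pred I) (F : I -> int) d :
  (forall i, P i -> (d %| F i)%Z) -> (d %| \sum_(i <- r | P i) F i)%Z.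
Proof.
by move=> dF; apply: (big_ind (fun z => (d %| z)%Z)) => // *; exact: rpredD.
Qed.

Lemma psum_shift a u n k :
  (u ^+ 2 %| psum (a + u) n k - psum a n k - k%:Z * u * psum a n k.-1)%Z.
Proof.
rewrite /psum mulr_sumr -!sumrB; apply: dvdz_sumr => i _.
by rewrite [a + u + _]addrAC; apply: dvdz_exprDl_taylor.
Qed.

(** Here u is the first term plus the last, so reversal pairs b with u - b; for odd k, (u - b)^k +
    b^k is k u b^(k-1) to first order in u. The modulus d is left abstract to accommodate both u^2
    and the sharper 3-adic modulus. *)
Lemma psum_reflect (a u d : int) n k : odd k -> u = a *+ 2 + n%:Z - 1 ->
    (forall b, (d %| (b + u) ^+ k - b ^+ k - k%:Z * u * b ^+ k.-1)%Z) ->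
  (d %| psum a n k *+ 2 - k%:Z * u * psum a n k.-1)%Z.
Proof.
move=> k_odd uE taylor; rewrite mulr2n {2}psum_rev -uE.
rewrite /psum mulr_sumr -big_split -sumrB; apply: dvdz_sumr => i _ /=.
have k1_even : odd k.-1 = false by case: k k_odd {taylor} => //= k /negbTE.
move: (a + i%:Z) => b; have := taylor (- b).
rewrite (exprNn b k) (exprNn b k.-1) -(signr_odd _ k) -(signr_odd _ k.-1)
  k_odd k1_even expr1 expr0 mul1r.
by rewrite mulN1r opprK [- _ + u]addrC [_ ^+ k + _]addrC.
Qed.

(** Block i is the first block translated by i L; expanding to first order and summing i over 0,
    ..., j - 1 produces the binomial coefficient. *)
Lemma psum_blocks (a : int) L j k :
  (L%:Z ^+ 2 %| psum a (L * j) k - j%:Z * psum a L k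
                - (k * 'C(j, 2))%N%:Z * L%:Z * psum a L k.-1)%Z.
Proof.
elim: j => [|j IHj].
  by rewrite muln0 psum0 bin0n muln0 !mul0r !subr0 dvdz0.
have -> : (L * j.+1)%N = (L * j + L)%N by rewrite mulnS addnC.
rewrite psumD binS bin1 mulnDr.
have /dvdzP[c cE] := psum_shift a (L * j)%N%:Z L k.
have -> := canRL (subrK _) (canRL (subrK _) cE).
have /dvdzP[c' c'E] := IHj.
have -> := canRL (subrK _) (canRL (subrK _) c'E).
apply/dvdzP; exists (c * j%:Z ^+ 2 + c').
by rewrite intS !(PoszD, PoszM); ring.
Qed.

Lemma psum_even_reflect (a : int) n k : ~~ odd k ->
  psum (1 - a - n%:Z) n k = psum a n k.
Proof.
move=> k_even; rewrite [RHS]psum_rev; apply: eq_bigr => i _.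
have -> : 1 - a - n%:Z + i%:Z = - (a *+ 2 + n%:Z - 1 - (a + i%:Z)) by ring.
by rewrite exprNn -signr_odd (negbTE k_even) mul1r.
Qed.

(** * Exact p-adic valuations of integers *)

(** Stated by two divisibilities, it forces a to be nonzero and depends only on a modulo p^(w+1), so
    it passes along congruences. *)
Definition exactly (p w : nat) (a : int) : bool :=
  ((p ^ w)%N%:Z %| a)%Z && ~~ ((p ^ w.+1)%N%:Z %| a)%Z.

Lemma exactlyE p w a : prime p ->
  exactly p w a = (a != 0) && (logn p `|a| == w).
Proof.
move=> p_pr; have [->|a_neq0] := eqVneq a 0; first by rewrite /exactly !dvdz0.
by rewrite /exactly !dvdzE /= !pfactor_dvdn ?absz_gt0 // -ltnNge ltnS eqn_leq andbC.
Qed.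

Lemma exactly_logn p n : prime p -> (0 < n)%N -> exactly p (logn p n) n%:Z.
Proof. by move=> p_pr n_gt0; rewrite exactlyE //= eqxx andbT -lt0n. Qed.

Lemma exactlyM p v w a b : prime p ->
  exactly p v a -> exactly p w b -> exactly p (v + w) (a * b).
Proof.
move=> p_pr; rewrite !exactlyE // => /andP[a0 /eqP<-] /andP[b0 /eqP<-].
by rewrite mulf_neq0 //= abszM lognM ?absz_gt0.
Qed.

Lemma exactlyMK p v w a b : prime p ->
  exactly p v a -> exactly p (v + w) (a * b) -> exactly p w b.
Proof.
move=> p_pr; rewrite !exactlyE // mulf_eq0 negb_or.
move=> /andP[a0 /eqP<-] /andP[/andP[_ b0]].
by rewrite b0 abszM lognM ?absz_gt0 // eqn_add2l.
Qed.

Lemma exactlyD p w a b :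
  ((p ^ w.+1)%N%:Z %| b)%Z -> exactly p w (a + b) = exactly p w a.
Proof.
move=> wb; have wb' : ((p ^ w)%N%:Z %| b)%Z.
  by apply: dvdz_trans wb; rewrite expnSr PoszM dvdz_mulr.
by rewrite /exactly !rpredDr.
Qed.

Lemma exactlyB p w a b :
  exactly p w b -> ((p ^ w.+1)%N%:Z %| a - b)%Z -> exactly p w a.
Proof. by move=> b_w ab; rewrite -[a](subrK b) addrC exactlyD. Qed.

Lemma exactlyN p w a : exactly p w (- a) = exactly p w a.
Proof. by rewrite /exactly !rpredN. Qed.

Lemma dvdz_pfactor p v w a : (v <= w)%N -> exactly p w a -> ((p ^ v)%N%:Z %| a)%Z.
Proof. by move=> vw /andP[wa _]; apply: dvdz_trans wa; rewrite dvdzE /= dvdn_exp2l. Qed.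

Lemma dvdz_expr_pfactor p v w k a :
  (v <= w * k)%N -> ((p ^ w)%N%:Z %| a)%Z -> ((p ^ v)%N%:Z %| a ^+ k)%Z.
Proof.
rewrite !dvdzE abszX /= => vwk wa; apply: (dvdn_trans (dvdn_exp2l p vwk)).
by rewrite expnM dvdn_exp2r.
Qed.

(** * Even exponents, for the primes 2 and 3 *)

(** For these two primes, every unit modulo p has square 1. *)
Lemma expr_even_mod23 (p k : nat) (a : int) : p = 2%N \/ p = 3%N ->
  (0 < k)%N -> ~~ odd k -> (p%:Z %| a ^+ k - (~~ (p%:Z %| a)%Z)%:Z)%Z.
Proof.
move=> p23 k_gt0 k_even.
have [pa|pa] /= := boolP (p%:Z %| a)%Z.
  by rewrite subr0 -(prednK k_gt0) exprS dvdz_mulr.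
have -> : k = (2 * k./2)%N by lia.
rewrite exprM (_ : 1%:Z = 1 ^+ k./2); last by rewrite expr1n.
rewrite subrXX dvdz_mulr //.
by case: p23 pa => -> pa; rewrite expr2; nia.
Qed.

(** Exactly one of p consecutive integers is a multiple of p; the other p - 1 contribute 1 each. *)
Lemma psum_prime_mod23 (p k : nat) (a : int) : p = 2%N \/ p = 3%N ->
  (0 < k)%N -> ~~ odd k -> (p%:Z %| psum a p k + 1)%Z.
Proof.
move=> p23 k_gt0 k_even.
have res b := expr_even_mod23 b p23 k_gt0 k_even.
have := res (a + 0%:Z); have := res (a + 1%:Z); have := res (a + 2%:Z).
by case: p23 => -> ; rewrite !psumS psum0; lia.
Qed.

(** Induction on m, cutting the sum into p blocks of length L = p^(m+1) t: the block congruence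
    multiplies the main term by p, and both L^2 and the cross term vanish modulo p^(m+2). *)
Lemma psum_pfactor_mod23 (p k m t : nat) (a : int) : p = 2%N \/ p = 3%N ->
  (0 < k)%N -> ~~ odd k ->
  ((p ^ m.+1)%N%:Z %| psum a (p ^ m.+1 * t) k + (p ^ m * t)%N%:Z)%Z.
Proof.
move=> p23 k_gt0 k_even; elim: m => [|m IHm].
  rewrite expn1 expn0 mul1n; elim: t => [|t IHt].
    by rewrite muln0 psum0 addr0 dvdz0.
  rewrite mulnSr psumD -addn1 PoszD addrACA rpredD //.
  exact: psum_prime_mod23.
set L := (p ^ m.+1 * t)%N in IHm *.
have -> : (p ^ m.+2 * t)%N = (L * p)%N by rewrite /L expnSr; lia.
have /dvdzP[c cE] := psum_blocks a L p k.
(* The cross term gains a factor p: 2 C(p,2) = p (p - 1) and k is even, which covers p = 2. *)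
have /dvdnP[q qE] : (p %| k * 'C(p, 2))%N.
  have -> : k = (k./2 * 2)%N by lia.
  by rewrite -mulnA -mul_bin_diag mulnCA dvdn_mulr.
have /dvdzP[c' c'E] := IHm; rewrite (expnS p m.+1).
have -> := canRL (subrK _) (canRL (subrK _) cE).
rewrite qE -[psum a L k](addrK (p ^ m * t)%N%:Z) c'E.
apply/dvdzP; exists (c * (p ^ m * t)%N%:Z * t%:Z + c' + q%:Z * t%:Z * psum a L k.-1).
rewrite /L !PoszM (expnS p m) !PoszM; ring.
Qed.

Lemma exactly_psum23 (p k n : nat) (a : int) : p = 2%N \/ p = 3%N ->
    (0 < k)%N -> ~~ odd k -> (0 < n)%N -> (p %| n)%N ->
  exactly p (logn p n).-1 (psum a n k).
Proof.
move=> p23 k_gt0 k_even n_gt0 pn.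
have p_pr : prime p by case: p23 => ->.
have := pfactor_dvdn 1 p_pr n_gt0; rewrite expn1 pn.
case: (logn p n) (exactly_logn p_pr n_gt0) => // m exn _ /=.
have /dvdnP[t tE] : (p ^ m.+1 %| n)%N by have /andP[] := exn; rewrite dvdzE.
rewrite mulnC in tE; have := psum_pfactor_mod23 m t a p23 k_gt0 k_even.
rewrite -tE -[X in _ + X]opprK; apply: exactlyB; rewrite exactlyN.
(* Since n = p (p^m t) has valuation m + 1, cancelling p leaves valuation m. *)
apply: (@exactlyMK p 1 m p%:Z) => //; last by rewrite -PoszM mulnA -expnS -tE.
by rewrite exactlyE // /= logn_prime // eqxx andbT; case: p23 => ->.
Qed.

Lemma exactly_T_even_dvd (p k x : nat) : p = 2%N \/ p = 3%N ->
    (0 < k)%N -> ~~ odd k -> (0 < x)%N -> (p %| x)%N ->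
  exactly p (logn p x).-1 (T k x).
Proof. by rewrite psum_T; exact: exactly_psum23. Qed.

(* The residues of [x + 1, ..., 2x] modulo [2x + 1] are the opposites of
   those of [1, ..., x], so [2 T] is the sum over a full residue system. *)
Lemma exactly3_T_even (k x : nat) : (0 < k)%N -> ~~ odd k ->
  (3 %| 2 * x + 1)%N -> exactly 3 (logn 3 (2 * x + 1)).-1 (T k x).
Proof.
move=> k_gt0 k_even x3; have N_gt0 : (0 < 2 * x + 1)%N by rewrite addn1.
have exN := exactly_logn (isT : prime 3) N_gt0.
have := exactly_psum23 0 (or_intror (erefl 3%N)) k_gt0 k_even N_gt0 x3.
have : (0 < logn 3 (2 * x + 1))%N by rewrite -pfactor_dvdn.
case: (logn 3 _) exN => //= w exN _ exS.
apply: (@exactlyMK 3 0 w 2) => //; apply: exactlyB exS _.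
have NE : psum 0 (2 * x + 1) k = psum 1 x k + psum x.+1%:Z x k.
  rewrite (_ : (2 * x + 1)%N = (x.+1 + x)%N); last by lia.
  by rewrite psumD psum_first expr0n (negbTE (lt0n_neq0 k_gt0)) /= !add0r.
have : ((2 * x + 1)%N%:Z %| psum 1 x k - psum x.+1%:Z x k)%Z.
  (* Reflection sends [x+1, 2x] to [-2x, -x-1], and translation by 2x + 1 brings this to [1, x]. *)
  rewrite -[psum x.+1%:Z x k]psum_even_reflect //.
  rewrite [X in psum X x k - _](_ : 1 = 1 - x.+1%:Z - x%:Z + (2 * x + 1)%N%:Z); last by lia.
  set a := 1 - _ - _.
  have /dvdzP[c cE] := psum_shift a (2 * x + 1)%N%:Z x k.
  rewrite (canRL (subrK _) cE); apply: rpredD; last exact/dvdz_mulr/dvdz_mull.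
  exact/dvdz_mull/dvdz_mulr.
rewrite NE -psum_T; have /andP[wN _] := exN => /(dvdz_trans wN).
by move: (psum 1 x k) (T k x)%:Z => A B; rewrite (_ : 2 * B - _ = - (A - B)) ?rpredN //; ring.
Qed.

(** For odd arguments: dropping the last term leaves an even number x of terms, and the dropped term
    is divisible by 2^k. *)
Lemma psum_T_pred (k x : nat) : (T k x.+1)%:Z = psum x.+2%:Z x k + (2 * x.+1)%N%:Z ^+ k.
Proof. by rewrite psum_T psumS; congr (_ + _ ^+ _); lia. Qed.

Lemma exactly2_expr_double (w k x : nat) : (w <= k)%N ->
  ((2 ^ w)%N%:Z %| (2 * x)%N%:Z ^+ k)%Z.
Proof.
move=> wk; apply: (@dvdz_expr_pfactor 2 w 1); first by rewrite mul1n.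
by rewrite dvdzE /= expn1 dvdn_mulr.
Qed.

Lemma exactly2_T_odd_even (k x : nat) : (0 < k)%N -> ~~ odd k -> (0 < x)%N ->
    (2 %| x)%N -> (logn 2 x <= k)%N ->
  exactly 2 (logn 2 x).-1 (T k x.+1).
Proof.
move=> k_gt0 k_even x_gt0 x2 xk.
rewrite psum_T_pred exactlyD; first by apply: exactly_psum23 => //; left.
by apply: exactly2_expr_double; apply: leq_trans xk; rewrite prednK // -pfactor_dvdn.
Qed.

(** * Odd exponents by reflection *)

(** Prepending x^k gives the interval [x, 2x], whose end terms sum to u = 3x. With w = v_2(x),
    reflection gives 2 (T + x^k) the valuation w + (w - 1), below that of the error u^2, and x^k is
    negligible. *)
Lemma exactly2_T_dvd4_odd (k x : nat) : (2 < k)%N -> odd k -> (0 < x)%N ->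
  (4 %| x)%N -> exactly 2 (2 * logn 2 x - 2) (T k x).
Proof.
move=> k_gt2 k_odd x_gt0 x4.
have ex := exactly_logn (isT : prime 2) x_gt0.
have w_gt1 : (1 < logn 2 x)%N by rewrite -(pfactor_dvdn 2).
have x2 : (2 %| x)%N by apply: dvdn_trans x4.
have k1_gt0 : (0 < k.-1)%N by lia.
have k1_even : ~~ odd k.-1 by lia.
have := exactly_psum23 x%:Z (or_introl (erefl 2%N)) k1_gt0 k1_even x_gt0 x2.
move: (logn 2 x) ex w_gt1 => w ex w_gt1 exS.
have [xw _] := andP ex.
have uE : 3 * x%:Z = x%:Z *+ 2 + x.+1%:Z - 1 by lia.
have := psum_reflect k_odd uE (fun b => dvdz_exprDl_taylor b _ k).
(* The sum of k-th powers is split at its first term to expose T; that of exponent k - 1 is split at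
   its last, leaving x terms. *)
rewrite psum_first -[x%:Z + 1]/(x%:Z + 1%:Z) -PoszD addn1 -psum_T psumS => D.
have exQ : exactly 2 w.-1 (psum x x k.-1 + (x%:Z + x%:Z) ^+ k.-1).
  rewrite exactlyD // prednK ?(ltnW w_gt1) //.
  by apply: (@dvdz_expr_pfactor 2 w w); [rewrite leq_pmulr | apply: rpredD].
have kodd2 : exactly 2 0 k%:Z by rewrite /exactly !dvdzE /= expn0 dvd1n dvdn2 k_odd.
have ex3 : exactly 2 0 3%:Z by [].
have exR := exactlyM (isT : prime 2) (exactlyM (isT : prime 2) kodd2
  (exactlyM (isT : prime 2) ex3 ex)) exQ.
have {}exR := exactlyB exR (dvdz_trans _ D).
have {D} /exR exP : ((2 ^ (0 + (0 + w) + w.-1).+1)%N%:Z %| (3 * x%:Z) ^+ 2)%Z.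
  by apply: (@dvdz_expr_pfactor 2 _ w); [clear - w_gt1; lia | exact: dvdz_mull].
apply: (@exactlyMK 2 1 _ 2) => //.
have -> : (1 + (2 * w - 2))%N = (0 + (0 + w) + w.-1)%N by clear - w_gt1; lia.
apply: exactlyB exP _.
rewrite (_ : _ - _ = - (2 * x%:Z ^+ k)); last by ring.
rewrite rpredN dvdz_mull //.
by apply: (@dvdz_expr_pfactor 2 _ w) => //; clear - w_gt1 k_gt2; nia.
Qed.

(** The same reflection of [x, 2x]. As 3 may divide k, the error must carry the factor 3^(v_3(k))
    too, which the 3-adic expansion supplies. *)
Lemma exactly3_T_odd (k x : nat) : (3 < k)%N -> odd k -> (0 < x)%N ->
  (3 %| x)%N -> exactly 3 (logn 3 (k * x ^ 2)) (T k x).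
Proof.
move=> k_gt3 k_odd x_gt0 x3.
have k_gt0 : (0 < k)%N by lia.
rewrite lognM ?expn_gt0 ?x_gt0 // lognX.
have ex := exactly_logn (isT : prime 3) x_gt0.
have exk := exactly_logn (isT : prime 3) k_gt0.
have w_gt0 : (0 < logn 3 x)%N by rewrite -(pfactor_dvdn 1).
have k1_gt0 : (0 < k.-1)%N by lia.
have k1_even : ~~ odd k.-1 by lia.
have := exactly_psum23 x%:Z (or_intror (erefl 3%N)) k1_gt0 k1_even x_gt0 x3.
(* This makes x^k negligible; it fails at k = 3, a case left to the closed form. *)
have vk : (logn 3 k + 3 <= k)%N.
  have : (3 ^ logn 3 k <= k)%N by apply: dvdn_leq => //; exact: pfactor_dvdnn.
  case: (logn 3 k) => [|[|v]]; [lia | lia |].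
  by have := ltn_expl v (isT : 1 < 3)%N; rewrite !expnS; lia.
have u3 : (3 %| 3 * x%:Z)%Z by apply: dvdz_mulr.
have uE : 3 * x%:Z = x%:Z *+ 2 + x.+1%:Z - 1 by lia.
have := psum_reflect k_odd uE (fun b => dvdz_exprDl_taylor3 b k_gt0 u3).
move: (logn 3 x) (logn 3 k) ex exk w_gt0 vk => w v ex exk w_gt0 vk D exS.
have [xw _] := andP ex.
move: D; rewrite psum_first -[x%:Z + 1]/(x%:Z + 1%:Z) -PoszD addn1 -psum_T psumS => D.
have exQ : exactly 3 w.-1 (psum x x k.-1 + (x%:Z + x%:Z) ^+ k.-1).
  rewrite exactlyD // prednK //.
  by apply: (@dvdz_expr_pfactor 3 w w); [rewrite leq_pmulr | apply: rpredD].
have ex3 : exactly 3 1 3%:Z by [].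
have exR := exactlyM (isT : prime 3) (exactlyM (isT : prime 3) exk
  (exactlyM (isT : prime 3) ex3 ex)) exQ.
have {}exR := exactlyB exR (dvdz_trans _ D).
have {D} /exR exP : ((3 ^ (v + (1 + w) + w.-1).+1)%N%:Z %|
    (3 ^ v)%N%:Z * (3 * x%:Z) ^+ 2)%Z.
  have -> : (v + (1 + w) + w.-1).+1 = (v + (w * 2 + 1))%N by clear - w_gt0; lia.
  rewrite expnD PoszM; apply: dvdz_mul => //.
  apply: (@dvdz_expr_pfactor 3 _ w.+1); first by clear; lia.
  by rewrite expnS PoszM dvdz_mul.
apply: (@exactlyMK 3 0 _ 2) => //.
have -> : (0 + (v + 2 * w))%N = (v + (1 + w) + w.-1)%N by clear - w_gt0; lia.
apply: exactlyB exP _.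
rewrite (_ : _ - _ = - (2 * x%:Z ^+ k)); last by ring.
rewrite rpredN dvdz_mull //.
by apply: (@dvdz_expr_pfactor 3 _ w) => //; clear - w_gt0 vk; nia.
Qed.

(** The end terms of the sum add up to u = 3(x+1) + 1, divisible by 8, and the sum of exponent k - 1
    has valuation 1. So 2 T has valuation w + 1 with w = v_2(u), while the error u^2 has 2w >= w +
    2. *)
Lemma exactly2_T_odd_odd4 (k x : nat) : (2 < k)%N -> odd k -> (0 < x)%N ->
  logn 2 x = 2%N -> exactly 2 (logn 2 (3 * x.+1 + 1)) (T k x.+1).
Proof.
move=> k_gt2 k_odd x_gt0 x4.
have x4d : (4 %| x)%N by rewrite -[4%N]/(2 ^ 2)%N pfactor_dvdn // x4.
have x8d : ~~ (8 %| x)%N by rewrite -[8%N]/(2 ^ 3)%N pfactor_dvdn // x4.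
have N_gt0 : (0 < 3 * x.+1 + 1)%N by lia.
have exN := exactly_logn (isT : prime 2) N_gt0.
have w_gt2 : (2 < logn 2 (3 * x.+1 + 1))%N by rewrite -(pfactor_dvdn 3) //; lia.
have k1_gt0 : (0 < k.-1)%N by lia.
have k1_even : ~~ odd k.-1 by lia.
have k1_ge2 : (logn 2 x <= k.-1)%N by lia.
have x2 : (2 %| x)%N by lia.
have := exactly2_T_odd_even k1_gt0 k1_even x_gt0 x2 k1_ge2.
rewrite x4 /= => exQ.
move: (logn 2 _) exN w_gt2 => w exN w_gt2.
have [Nw _] := andP exN.
have uE : (3 * x.+1 + 1)%N%:Z = x.+2%:Z *+ 2 + x.+1%:Z - 1 by lia.
have := psum_reflect k_odd uE (fun b => dvdz_exprDl_taylor b _ k).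
rewrite -!psum_T => D.
have kodd2 : exactly 2 0 k%:Z by rewrite /exactly !dvdzE /= expn0 dvd1n dvdn2 k_odd.
have exR := exactlyM (isT : prime 2) (exactlyM (isT : prime 2) kodd2 exN) exQ.
have {}exR := exactlyB exR (dvdz_trans _ D).
have {D} /exR exP : ((2 ^ (0 + w + 1).+1)%N%:Z %| (3 * x.+1 + 1)%N%:Z ^+ 2)%Z.
  by apply: (@dvdz_expr_pfactor 2 _ w); [clear - w_gt2; lia |].
apply: (@exactlyMK 2 1 _ 2) => //.
by rewrite mulr_natl (_ : (1 + w)%N = (0 + w + 1)%N) //; clear; lia.
Qed.

(** * Odd exponents by doubling, for sums of length divisible by 8 *)

(** In a block b, ..., b + 3 the even terms have k-th powers divisible by 8, and the odd ones cancel
    modulo their sum 2b + 4, a multiple of 8. *)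
Lemma dvdz8_psum4 (a : int) (k h : nat) : (2 < k)%N -> odd k ->
  (4 %| a - 2)%Z -> (8 %| psum a (4 * h) k)%Z.
Proof.
move=> k_gt2 k_odd a2; elim: h => [|h IHh]; first by rewrite muln0 psum0 dvdz0.
rewrite mulnSr psumD rpredD //.
have {a2 IHh} : (4 %| a + (4 * h)%N%:Z - 2)%Z by lia.
set b : int := a + _; move: b => b b2; rewrite !psumS psum0 add0r.
have sum4AC (p q r s : int) : p + q + r + s = (p + r) + (q + s).
  by rewrite [RHS]addrACA addrA.
rewrite sum4AC.
have even_cube c : (2 %| c)%Z -> (8 %| c ^+ k)%Z.
  by move=> c2; apply: (@dvdz_expr_pfactor 2 3 1); first by rewrite mul1n.
apply: rpredD; first by apply: rpredD; apply: even_cube; lia.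
have -> : b + 3%:Z = - (b + 1%:Z) + (2 * b + 4) by ring.
have /dvdzP[c cE] := dvdz_exprDl_taylor (- (b + 1%:Z)) (2 * b + 4) k.
rewrite (canRL (subrK _) (canRL (subrK _) cE)) (exprNn _ k) -(signr_odd _ k) k_odd.
rewrite expr1 mulN1r addrCA subrr addr0.
have b8 : (8 %| 2 * b + 4)%Z by lia.
by rewrite expr2 mulrA rpredD // dvdz_mulr // dvdz_mull.
Qed.

Lemma exactly2_psum_odd (a : int) (k e h : nat) : (2 < k)%N -> odd k ->
    (4 %| a - 2)%Z -> odd h ->
  exactly 2 e.+3 (psum a (2 ^ e.+3 * h) k).
Proof.
move=> k_gt2 k_odd a2 h_odd.
have h_gt0 : (0 < h)%N by case: h h_odd.
have exh : exactly 2 0 h%:Z by rewrite /exactly !dvdzE /= expn0 dvd1n dvdn2 h_odd.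
have kodd2 : exactly 2 0 k%:Z by rewrite /exactly !dvdzE /= expn0 dvd1n dvdn2 k_odd.
have k1_gt0 : (0 < k.-1)%N by lia.
have k1_even : ~~ odd k.-1 by lia.
have exX m : exactly 2 m (2 ^ m)%N%:Z.
  by rewrite -[in exactly _ m](pfactorK m (isT : prime 2)) exactly_logn ?expn_gt0.
have exL m : exactly 2 m (2 ^ m * h)%N%:Z.
  by rewrite PoszM -[m in exactly _ m]addn0; apply: exactlyM.
have exS m : exactly 2 m (psum a (2 ^ m.+1 * h) k.-1).
  have L_gt0 : (0 < 2 ^ m.+1 * h)%N by rewrite muln_gt0 expn_gt0.
  have L2 : (2 %| 2 ^ m.+1 * h)%N by rewrite expnS -mulnA dvdn_mulr.
  have := exactly_psum23 a (or_introl (erefl 2%N)) k1_gt0 k1_even L_gt0 L2.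
  by have := exL m.+1; rewrite exactlyE // => /andP[_ /eqP->].
have double m : exactly 2 (m.+2 + m.+1)
    (k%:Z * (2 ^ m.+2 * h)%N%:Z * psum a (2 ^ m.+2 * h) k.-1).
  exact: exactlyM (isT : prime 2) (exactlyM (isT : prime 2) kodd2 (exL _)) (exS _).
have step m : ((2 ^ (m.+2 * 2))%N%:Z %| psum a (2 ^ m.+3 * h) k
    - (2 * psum a (2 ^ m.+2 * h) k
       + k%:Z * (2 ^ m.+2 * h)%N%:Z * psum a (2 ^ m.+2 * h) k.-1))%Z.
  have := psum_blocks a (2 ^ m.+2 * h) 2 k.
  rewrite muln1 mulnAC -expnSr opprD addrA; apply: dvdz_trans.
  by apply: (@dvdz_expr_pfactor 2 _ m.+2) => //; have /andP[] := exL m.+2.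
(* From length 4h to 8h the doubled sum is divisible by 16, so the cross term, of valuation 3,
   decides. Afterwards the cross term has valuation 2e + 5, and the doubled sum, of valuation e + 4,
   decides. *)
elim: e => [|e IHe].
  apply: exactlyB (dvdz_trans _ (step 0%N)) => //.
  rewrite addrC exactlyD //; first exact: double.
  by rewrite -[(2 ^ 4)%N]/(2 * 8)%N PoszM dvdz_mul // dvdz8_psum4.
apply: exactlyB (dvdz_trans _ (step e.+1)).
  rewrite exactlyD; first exact: (@exactlyM 2 1 e.+3 2).
  by apply: (dvdz_pfactor _ (double _)); lia.
by rewrite dvdzE /= dvdn_exp2l //; lia.
Qed.

Lemma exactly2_T_odd_odd8 (k x : nat) : odd k -> (0 < x)%N ->
    (2 < logn 2 x)%N -> (logn 2 x < k)%N ->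
  exactly 2 (logn 2 x) (T k x.+1).
Proof.
move=> k_odd x_gt0; have [h h_odd xE] := pfactor_coprime (isT : prime 2) x_gt0.
rewrite psum_T_pred; case: (logn 2 x) xE => [|[|[|e]]] // xE _ ek.
rewrite exactlyD; last exact: exactly2_expr_double.
rewrite [X in psum _ X k]xE mulnC; apply: exactly2_psum_odd; [lia | done | | by rewrite -coprime2n].
by rewrite xE !expnSr; lia.
Qed.

(** * From valuations to exponents; closed forms for small k *)

(** Here w = n v_p(y), and w > 0 forces v_p(y) >= 1. *)
Lemma leq_exactly_pow (p w n m : nat) (y : int) : prime p ->
  exactly p w m%:Z -> m%:Z = y ^+ n -> (0 < w)%N -> (n <= w)%N.
Proof.
move=> p_pr; rewrite exactlyE // => /andP[_ /eqP<-] ->.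
by rewrite abszX lognX muln_gt0 => /andP[n_gt0 y_gt0]; rewrite leq_pmulr.
Qed.

Lemma psum_expr1 (a : int) n : 2 * psum a n 1 = n%:Z * (2 * a + n%:Z - 1).
Proof. by elim: n => [|n IHn]; [rewrite psum0 | rewrite psumS mulrDr IHn intS]; ring. Qed.

Lemma psum_expr2 (a : int) n : 6 * psum a n 2 =
  n%:Z * (6 * a ^+ 2 + 6 * a * (n%:Z - 1) + (n%:Z - 1) * (2 * n%:Z - 1)).
Proof. by elim: n => [|n IHn]; [rewrite psum0 | rewrite psumS mulrDr IHn intS]; ring. Qed.

Lemma psum_expr3 (a : int) n : 4 * psum a n 3 =
  n%:Z * (2 * a + n%:Z - 1) * (2 * a ^+ 2 + 2 * a * (n%:Z - 1) + n%:Z * (n%:Z - 1)).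
Proof. by elim: n => [|n IHn]; [rewrite psum0 | rewrite psumS mulrDr IHn intS]; ring. Qed.

Lemma T1E x : (2 * T 1 x = x * (3 * x + 1))%N.
Proof.
apply/eqP; rewrite -eqz_nat PoszM psum_T psum_expr1; apply/eqP.
by rewrite intS !(PoszM, PoszD); ring.
Qed.

Lemma T2E x : (6 * T 2 x = x * (2 * x + 1) * (7 * x + 1))%N.
Proof.
apply/eqP; rewrite -eqz_nat PoszM psum_T psum_expr2; apply/eqP.
by rewrite intS !(PoszM, PoszD); ring.
Qed.

Lemma T3E x : (4 * T 3 x = x ^ 2 * (5 * x + 3) * (3 * x + 1))%N.
Proof.
apply/eqP; rewrite -eqz_nat PoszM psum_T psum_expr3; apply/eqP.
by rewrite intS -mulnn !(PoszM, PoszD); ring.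
Qed.

(* Assembly of the cases *)
Local Close Scope ring_scope.

Theorem theorem2p1 (x k n : nat) (y : int)
    (hx : 1 <= x) (hk : 1 <= k) (hn : 2 <= n)
    (hT : ((T k x)%:Z = y ^+ n)%R) :
  (* (i) *)
  (x = 0 %[mod 4] ->
     (k = 1 \/ ~~ odd k -> (n%:Z <= (logn 2 x)%:Z - 1)%R) /\
     (3 <= k /\ odd k -> (n%:Z <= 2 * (logn 2 x)%:Z - 2)%R)) /\
  (* (ii) *)
  ((x = 1 %[mod 4] /\ k = 1 ->
     (n%:Z <= (logn 2 (3 * x + 1))%:Z - 1)%R) /\
   ((x = 1 %[mod 8] \/ x = 5 %[mod 8]) /\ x <> 1 %[mod 32] /\ k <> 1 ->
     (x = 1 %[mod 8] /\ k = 2 ->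
        (n%:Z <= (logn 2 (7 * x + 1))%:Z - 1)%R) /\
     (x = 1 %[mod 8] /\ k = 3 ->
        (n%:Z <= (logn 2 ((5 * x + 3) * (3 * x + 1)))%:Z - 2)%R) /\
     (x = 5 %[mod 8] /\ 3 <= k /\ odd k ->
        (n%:Z <= (logn 2 (3 * x + 1))%:Z)%R) /\
     (x = 5 %[mod 8] /\ 2 <= k /\ ~~ odd k -> (n%:Z <= 1)%R) /\
     (x = 9 %[mod 16] /\ 4 <= k /\ ~~ odd k -> (n%:Z <= 2)%R) /\
     ((x = 9 %[mod 16] /\ 5 <= k /\ odd k) \/
      (x = 17 %[mod 32] /\ 4 <= k /\ ~~ odd k) -> (n%:Z <= 3)%R) /\
     (x = 17 %[mod 32] /\ 5 <= k /\ odd k -> (n%:Z <= 4)%R))) /\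
  (* (iii) *)
  ((x = 0 %[mod 3] /\ odd k) \/
   ((x = 0 %[mod 9] \/ x = 4 %[mod 9]) /\ 2 <= k /\ ~~ odd k) ->
     (x = 0 %[mod 3] /\ k = 1 -> (n%:Z <= (logn 3 x)%:Z)%R) /\
     (x = 0 %[mod 9] /\ 2 <= k /\ ~~ odd k ->
        (n%:Z <= (logn 3 x)%:Z - 1)%R) /\
     (x = 0 %[mod 3] /\ 3 < k /\ odd k ->
        (n%:Z <= (logn 3 (k * x ^ 2))%:Z)%R) /\
     (x = 0 %[mod 3] /\ k = 3 ->
        (n%:Z <= (logn 3 (x ^ 2 * (5 * x + 3)))%:Z)%R) /\
     (x = 4 %[mod 9] /\ 2 <= k /\ ~~ odd k ->
        (n%:Z <= (logn 3 (2 * x + 1))%:Z - 1)%R)).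
Proof.
have bound p w (p_pr : prime p) (ex : exactly p w (T k x)) := leq_exactly_pow p_pr ex hT.
have logn_ge2 m p : 0 < m -> prime p -> p ^ 2 %| m -> 1 < logn p m.
  by move=> m_gt0 p_pr; rewrite pfactor_dvdn.
have logn2 m e : 2 ^ e %| m -> ~~ (2 ^ e.+1 %| m) -> 0 < m /\ logn 2 m = e.
  case: m => [|m]; first by rewrite !dvdn0.
  rewrite !pfactor_dvdn // -ltnNge ltnS => ? ?.
  by split=> //; apply/eqP; rewrite eqn_leq; apply/andP.
(* A closed form c T = d yields v_p(T) = v_p(d) - v_p(c), which must be positive to bound n. *)
have cofactor p w c d (p_pr : prime p) (cT : c * T k x = d) (d_gt0 : 0 < d)
    (ex : exactly p w c) : w < logn p d -> n <= logn p d - w.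
  move=> wd; apply: (bound p) => //; last by rewrite subn_gt0.
  apply: (exactlyMK p_pr ex); rewrite subnKC ?(ltnW wd) // -PoszM cT.
  exact: exactly_logn.
have closed1 : k = 1 -> 2 * T k x = x * (3 * x + 1) by move->; exact: T1E.
have closed2 : k = 2 -> 6 * T k x = x * (2 * x + 1) * (7 * x + 1) by move->; exact: T2E.
have closed3 : k = 3 -> 4 * T k x = x ^ 2 * (5 * x + 3) * (3 * x + 1) by move->; exact: T3E.
have factor p a b : prime p -> 0 < a -> 0 < b -> ~~ (p %| a) -> logn p (a * b) = logn p b.
  by move=> p_pr a_gt0 b_gt0 pa; rewrite lognM // logn_coprime // prime_coprime.
split; [move=> x4 | split; [split; [case=> x4 k1 | move=> [x8 [x32 kn1]]] | move=> _]].
- have x4d : 4 %| x by lia.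
  have v2 := logn_ge2 x 2 hx isT x4d.
  split=> [k1_even | [k_ge3 k_odd]].
    (* As v_2(x) >= 2, truncated and integer subtraction agree. *)
    suff : n <= (logn 2 x).-1 by move: v2; clear; lia.
    case: k1_even => [k1 | k_even].
      have := cofactor 2 1 _ _ isT (closed1 k1).
      rewrite [x * _]mulnC factor ?addn_gt0 ?orbT //; last by lia.
      by rewrite -subn1 muln_gt0 hx addn_gt0 orbT; apply.
    apply: (bound 2) => //; last by move: v2; clear; lia.
    by apply: exactly_T_even_dvd => //; [left | lia].
  suff : n <= 2 * logn 2 x - 2 by move: v2; clear; lia.
  by apply: (bound 2 _ isT (exactly2_T_dvd4_odd _ _ _ _)) => //; move: v2; clear; lia.
- have x3d : 4 %| 3 * x + 1 by move: x4; clear; lia.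
  have v2 := logn_ge2 _ 2 (ltn_addl _ (isT : 0 < 1)) isT x3d.
  suff : n <= logn 2 (3 * x + 1) - 1 by move: v2; clear; lia.
  have := cofactor 2 1 _ _ isT (closed1 k1).
  rewrite factor ?addn_gt0 ?orbT //; last by move: x4; clear; lia.
  by rewrite muln_gt0 hx addn_gt0 orbT; apply.
(* From here the argument of T is [x.+1], so [x] is the original x minus 1. *)
- case: x hx hT x8 x32 bound closed1 closed2 closed3 cofactor => // x _ _ x8 x32.
  move=> bound _ closed2 closed3 cofactor.
  (* Here e is the valuation of the original x - 1: 2, 3 or 4 for the residues 5 mod 8, 9 mod 16 and
     17 mod 32. *)
  have even_case e : 2 ^ e %| x -> ~~ (2 ^ e.+1 %| x) -> 1 < e -> e <= k ->
      ~~ odd k -> n <= e.-1.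
    move=> xe xe1 e_gt1 ek k_even; have [x_gt0 v2] := logn2 _ _ xe xe1.
    apply: (bound 2) => //; last by move: e_gt1; clear; lia.
    rewrite -v2; apply: exactly2_T_odd_even; rewrite ?v2 //.
    by apply: dvdn_trans xe; apply: dvdn_exp; rewrite // ltnW.
  have odd_case e : 2 ^ e %| x -> ~~ (2 ^ e.+1 %| x) -> 2 < e -> e < k ->
      odd k -> n <= e.
    move=> xe xe1 e_gt2 ek k_odd; have [x_gt0 v2] := logn2 _ _ xe xe1.
    apply: (bound 2) => //; last by move: e_gt2; clear; lia.
    by rewrite -v2; apply: exactly2_T_odd_odd8; rewrite ?v2.
  split; [|split; [|split; [|split; [|split; [|split]]]]].
  + move=> [x1 k2]; have x7d : 2 ^ 2 %| 7 * x.+1 + 1 by move: x1; clear; lia.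
    have v2 := logn_ge2 _ 2 (ltn_addl _ (isT : 0 < 1)) isT x7d.
    suff : n <= logn 2 (7 * x.+1 + 1) - 1 by move: v2; clear; lia.
    have := cofactor 2 1 _ _ isT (closed2 k2).
    rewrite factor ?addn_gt0 ?orbT //; last by rewrite Euclid_dvdM // negb_or; move: x1; clear; lia.
    by rewrite !muln_gt0 !addn_gt0 !orbT; apply.
  + move=> [x1 k3]; set N := (_ * _).
    have N_gt0 : 0 < N by rewrite muln_gt0 !addn_gt0 orbT.
    (* The factor 5x + 3 alone is divisible by 8, so v_2(N) exceeds v_2(4) = 2. *)
    have N8 : 2 ^ 3 %| N by apply: dvdn_mulr; move: x1; clear; lia.
    have v2 : 2 < logn 2 N by rewrite -pfactor_dvdn.
    suff : n <= logn 2 N - 2 by move: v2; clear; lia.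
    have := cofactor 2 2 _ _ isT (closed3 k3).
    rewrite -mulnA factor ?expn_gt0 //; last by rewrite Euclid_dvdX // andbT; move: x1; clear; lia.
    by rewrite muln_gt0 expn_gt0; apply.
  + move=> [x5 [k_ge3 k_odd]].
    have [||x_gt0 v2] := logn2 x 2; [move: x5; clear; lia | move: x5; clear; lia |].
    rewrite lez_nat; apply: (bound 2) => //; first exact: exactly2_T_odd_odd4.
    by rewrite -(pfactor_dvdn 1) ?addn1 //; move: x5; clear; lia.
  + move=> [x5 [k_ge2 k_even]].
    by apply: (even_case 2) => //; move: x5; clear; lia.
  + move=> [x9 [k_ge4 k_even]].
    by apply: (even_case 3) => //; [move: x9; clear; lia | move: x9; clear; lia | exact: ltnW].
  + case=> [[x9 [k_ge5 k_odd]] | [x17 [k_ge4 k_even]]].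
      by apply: (odd_case 3) => //; [move: x9; clear; lia | move: x9; clear; lia | exact: ltnW].
    by apply: (even_case 4) => //; move: x17; clear; lia.
  + move=> [x17 [k_ge5 k_odd]].
    by apply: (odd_case 4) => //; move: x17; clear; lia.
- split; [|split; [|split; [|split]]].
  + move=> [x3 k1]; have x3d : 3 %| x by move: x3; clear; lia.
    have v3 : 0 < logn 3 x by rewrite -(pfactor_dvdn 1).
    have := cofactor 3 0 _ _ isT (closed1 k1).
    rewrite [in logn _ _]mulnC factor ?addn_gt0 ?orbT //; last by move: x3; clear; lia.
    by rewrite subn0 muln_gt0 hx addn_gt0 orbT; apply.
  + move=> [x9 [k_ge2 k_even]]; have x9d : 3 ^ 2 %| x by move: x9; clear; lia.
    have v3 := logn_ge2 x 3 hx isT x9d.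
    suff : n <= (logn 3 x).-1 by move: v3; clear; lia.
    apply: (bound 3) => //; last by move: v3; clear; lia.
    by apply: exactly_T_even_dvd => //; [right | move: x9; clear; lia].
  + move=> [x3 [k_gt3 k_odd]]; have x3d : 3 %| x by move: x3; clear; lia.
    rewrite lez_nat; apply: (bound 3) => //; first exact: exactly3_T_odd.
    rewrite -(pfactor_dvdn 1) ?muln_gt0 ?hk ?expn_gt0 ?hx //.
    by rewrite -mulnn mulnA dvdn_mull.
  + move=> [x3 k3]; set N := (_ * _).
    have N_gt0 : 0 < N by rewrite muln_gt0 addn_gt0 orbT expn_gt0 hx.
    have N3 : 3 ^ 1 %| N by apply: dvdn_mull; move: x3; clear; lia.
    have v3 : 0 < logn 3 N by rewrite -pfactor_dvdn.
    have := cofactor 3 0 _ _ isT (closed3 k3).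
    rewrite [in logn _ _]mulnC factor ?addn_gt0 ?orbT //; last by move: x3; clear; lia.
    by rewrite subn0 muln_gt0 N_gt0 addn_gt0 orbT; apply.
  + move=> [x4 [k_ge2 k_even]]; have x9d : 3 ^ 2 %| 2 * x + 1 by move: x4; clear; lia.
    have v3 := logn_ge2 _ 3 (ltn_addl _ (isT : 0 < 1)) isT x9d.
    suff : n <= (logn 3 (2 * x + 1)).-1 by move: v3; clear; lia.
    apply: (bound 3) => //; last by move: v3; clear; lia.
    by apply: exactly3_T_even => //; apply: dvdn_trans x9d.
Qed.
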